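(* Suppose all groups are extreme, i.e. $y_j\in\{0,n_j\}$ for every $j=1,\dots,k$, and that only an intercept term is used, i.e. $m=1$ and $\boldsymbol x_j^\top\boldsymbol\beta=\beta_1$ for all $j$. Let $f$ be a proper hyper-prior probability density function on $(0,\infty)$ for $r$, and independently let $\beta_1$ have the improper flat hyper-prior density $g(\beta_1)\propto 1$ on $\mathbf R$. Then the posterior density function of the hyper-parameters, $\pi_{\mathrm{hyp.post}}(r,\beta_1\mid\boldsymbol y)\propto f(r)\,g(\beta_1)\,L(r,\beta_1)$, is proper if and only if there are at least one extreme group with all successes and at least one extreme group with all failures, i.e. $\sum_{j=1}^k I_{\{y_j=n_j\}}\ge 1$ and $\sum_{j=1}^k I_{\{y_j=0\}}\ge 1$.
   Context: Beta-Binomial-Logit model with only an intercept. There are $k\ge 1$ groups; group $j$ has an integer number of trials $n_j\ge 1$ and an observed number of successes $y_j\in\{0,1,\dots,n_j\}$; $\boldsymbol y=(y_1,\dots,y_k)^\top$. The hyper-parameters are $r\in(0,\infty)$ and $\beta_1\in\mathbf R$. Write $p^E=\exp(\beta_1)/(1+\exp(\beta_1))$ and $q^E=1-p^E$. The likelihood function (a product of Beta-Binomial probability mass functions) is $$L(r,\beta_1)=\prod_{j=1}^k\binom{n_j}{y_j}\frac{B(y_j+rp^E,\;n_j-y_j+rq^E)}{B(rp^E,\;rq^E)},$$ where $B(a,b)=\int_0^1 v^{a-1}(1-v)^{b-1}\,dv$ for $a,b>0$ is the beta function. $I_{\{D\}}$ denotes the indicator of $D$. The posterior $\pi_{\mathrm{hyp.post}}(r,\beta_1\mid\boldsymbol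 y)\propto f(r)g(\beta_1)L(r,\beta_1)$ is called proper if $\int_{\mathbf R}\int_0^\infty f(r)g(\beta_1)L(r,\beta_1)\,dr\,d\beta_1<\infty$ and improper if this integral is infinite. *)

(* Defs.v *)
From HB Require Import structures.
From mathcomp Require Import all_boot all_order all_algebra.
From mathcomp Require Import all_classical all_reals all_analysis.

Set Implicit Arguments.
Unset Strict Implicit.
Unset Printing Implicit Defensive.

Import Order.TTheory GRing.Theory Num.Theory.
Import numFieldNormedType.Exports.

Local Open Scope classical_set_scope.
Local Open Scope ring_scope.

(* The library's [beta_fun] only takes natural-number arguments. The integral
   is finite exactly when [0 < a] and [0 < b]; otherwise the real-valued
   integral returns the junk value 0. *)
Definition Beta (R : realType) (a b : R) : R :=
  \int[@lebesgue_measure R]_(v in `]0, 1[)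
    (v `^ (a - 1) * (1 - v) `^ (b - 1)).

Definition pE (R : realType) (beta1 : R) : R :=
  expR beta1 / (1 + expR beta1).

Definition qE (R : realType) (beta1 : R) : R := 1 - pE beta1.

Definition likelihood (R : realType) (k : nat) (n y : 'I_k -> nat)
    (r beta1 : R) : R :=
  \prod_(j < k)
    ('C(n j, y j)%:R *
     (Beta ((y j)%:R + r * pE beta1) ((n j - y j)%:R + r * qE beta1) /
      Beta (r * pE beta1) (r * qE beta1))).

Definition is_pdf_on_pos (R : realType) (f : R -> R) : Prop :=
  [/\ measurable_fun (`]0, +oo[ : set R) f,
      forall r, 0 < r -> 0 <= f r &
      (\int[@lebesgue_measure R]_(r in `]0%R, +oo[) (f r)%:E = 1)%E].

Definition is_flat (R : realType) (g : R -> R) : Prop :=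
  exists2 c : R, 0 < c & forall beta1, g beta1 = c.

Definition hyp_post_mass (R : realType) (k : nat) (n y : 'I_k -> nat)
    (f g : R -> R) : \bar R :=
  (\int[@lebesgue_measure R]_(beta1 in [set: R])
     \int[@lebesgue_measure R]_(r in `]0%R, +oo[)
       (f r * g beta1 * likelihood n y r beta1)%:E)%E.

Definition hyp_post_proper (R : realType) (k : nat) (n y : 'I_k -> nat)
    (f g : R -> R) : Prop :=
  (hyp_post_mass n y f g < +oo)%E.

(* Main.v *)
(* Writing p = pE and q = qE, the Beta recurrence a B(a,b) = (a+b) B(a+1,b) (and its mirror
   image in b) turns an all-success factor of the likelihood into the product over i < n_j of
   (r p + i)/(r + i), and an all-failure factor into the same product with q in place of p.
   Each term lies in [p, 1] (resp. [q, 1]) and the term i = 0 is exactly p (resp. q). So with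
   both kinds of groups L <= p q, which is integrable in beta_1 since p' = p q, while with only
   successes (resp. failures) L >= p^N (resp. q^N) with N the sum of the n_j, which stays
   above 2^-N on a half-line. In both cases the bound is uniform in r and f integrates to 1. *)
Require Import Defs.
From HB Require Import structures.
From mathcomp Require Import all_boot all_order all_algebra.
From mathcomp Require Import all_classical all_reals all_analysis.
From mathcomp Require Import measurable_realfun ring lra.

Set Implicit Arguments.
Unset Strict Implicit.
Unset Printing Implicit Defensive.

Import Order.TTheory GRing.Theory Num.Theory.
Import numFieldNormedType.Exports.

Local Open Scope classical_set_scope.
Local Open Scope ring_scope.

(** The integral of a nonnegative function is a supremum over the simple functions below it, and a
    larger function admits more of them. This covers inner integrals whose measurability in [beta1]
    is not established. *)
Lemma le_ge0_integral d (T : measurableType d) (R : realType)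
    (mu : {measure set T -> \bar R}) (D : set T) (f g : T -> \bar R) :
  (forall x, D x -> 0 <= f x)%E -> (forall x, D x -> f x <= g x)%E ->
  (\int[mu]_(x in D) f x <= \int[mu]_(x in D) g x)%E.
Proof.
move=> f0 fg; have g0 x : D x -> (0 <= g x)%E.
  by move=> Dx; exact: le_trans (f0 _ Dx) (fg _ Dx).
rewrite !ge0_integralE//; apply: ereal_sup_le => _ [h hf <-].
exists h => //= x; apply: le_trans (hf x) _; rewrite /patch.
by case: ifPn => //; rewrite inE => /fg.
Qed.

(** * The Beta integrand: pointwise bounds and derivative *)

Section beta_kernel.
Variable R : realType.
Implicit Types a b x y v : R.
Local Notation mu := (@lebesgue_measure R).

(** The exponents are [x] and [y] rather than [a - 1] and [b - 1], so that the same function serves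
    as integrand and, with exponents [a] and [b], as antiderivative. *)
Definition beta_kernel x y v : R := v `^ x * (1 - v) `^ y.

(* Extended-real valued, so that the recurrences below can be established before (and
   then used to prove) convergence of the integral. *)
Definition ebeta a b : \bar R :=
  (\int[mu]_(v in `]0%R, 1%R[) (beta_kernel (a - 1) (b - 1) v)%:E)%E.

Lemma Beta_ebeta a b : Beta a b = fine (ebeta a b).
Proof. by []. Qed.

Lemma beta_kernel_ge0 x y v : 0 <= beta_kernel x y v.
Proof. by rewrite mulr_ge0// powR_ge0. Qed.

Lemma beta_kernel_sym x y v : beta_kernel x y (1 - v) = beta_kernel y x v.
Proof. by rewrite /beta_kernel mulrC; congr (_ `^ _ * _); ring. Qed.

(** Multiply by [1 = v + (1 - v)]. *)
Lemma beta_kernel_split x y v : 0 < v < 1 ->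
  beta_kernel x y v = beta_kernel (x + 1) y v + beta_kernel x (y + 1) v.
Proof.
move=> /andP[v0 v1]; have w0 : 0 < 1 - v by rewrite subr_gt0.
have powRS u z : 0 < u -> u `^ (z + 1) = u `^ z * u.
  by move=> u0; rewrite powRD ?powRr1 ?(gt_eqF u0) ?implybT// ltW.
by rewrite /beta_kernel !powRS//; ring.
Qed.

Lemma beta_kernel_le1 x y v : 0 <= x -> 0 <= y -> 0 < v < 1 ->
  beta_kernel x y v <= 1.
Proof.
move=> x0 y0 /andP[v0 v1]; have w0 : 0 < 1 - v by rewrite subr_gt0.
rewrite -[leRHS]mul1r ler_pM ?powR_ge0// -[leRHS](@powRr0 _ v) //.
- by rewrite ger_powR// v0 ltW.
- by rewrite powRr0 -[leRHS](@powRr0 _ (1 - v)) ger_powR// w0 gerBl ltW.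
Qed.

Lemma beta_kernel_le_powR x y v : 0 <= y -> 0 < v < 1 ->
  beta_kernel x y v <= v `^ x.
Proof.
move=> y0 /andP[v0 v1]; have w0 : 0 < 1 - v by rewrite subr_gt0.
rewrite ler_piMr ?powR_ge0// -[leRHS](@powRr0 _ (1 - v)).
by rewrite ger_powR// w0 gerBl ltW.
Qed.

Lemma measurable_beta_kernel x y (D : set R) :
  measurable_fun D (beta_kernel x y).
Proof.
apply: measurable_funTS; apply: measurable_funM; first exact: measurable_powR.
apply: (@measurableT_comp _ _ _ _ _ _ (@powR R ^~ y)) => //.
exact: measurable_funB.
Qed.

Lemma is_derive_beta_kernel x y v : 0 < v < 1 ->
  is_derive v 1 (beta_kernel x y)
    (x * beta_kernel (x - 1) y v - y * beta_kernel x (y - 1) v).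
Proof.
move=> /andP[v0 v1]; have w0 : 0 < 1 - v by rewrite subr_gt0.
have h1 : is_derive v 1 (fun u : R => 1 - u) (- 1).
  by rewrite -[- 1](add0r (- 1)); apply: is_deriveB.
have h2 := @is_derive1_comp R (@powR R ^~ y) (fun u => 1 - u) v _ _ (is_derive1_powR y w0) h1.
have h3 := is_derive1_powR x v0.
have := is_deriveM h3 h2.
move=> H; apply: is_derive_eq.
by rewrite /beta_kernel /= /GRing.scale/=; ring.
Qed.

End beta_kernel.

(** * Recurrences, finiteness and positivity of the Beta function *)

Section beta_recurrence.
Variable R : realType.
Implicit Types a b x y v : R.
Local Notation mu := (@lebesgue_measure R).

(* Exhaustion of ]0, 1[ by compact intervals: the kernel may blow up at both ends. *)
Let eps (i : nat) : R := i.+3%:R^-1.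
Let D (i : nat) : set R := `[eps i, 1 - eps i]%classic.

Let eps_gt0 i : 0 < eps i. Proof. by rewrite invr_gt0. Qed.

(** The offset 3 in [eps] gives [eps i <= 1/3], so every [D i] is a nondegenerate interval. *)
Let eps_lt i : eps i < 1 - eps i.
Proof.
have : eps i <= 3^-1 by rewrite lef_pV2 ?posrE// ler_nat.
by lra.
Qed.

Let eps_cvg : eps i @[i --> \oo] --> (0 : R).
Proof.
have -> : eps = (fun n => @harmonic R (n + 2)%N).
  by apply/funext => n; rewrite /harmonic addn2.
by rewrite (cvg_shiftn 2 (@harmonic R)); exact: cvg_harmonic.
Qed.

Let D_sub i v : D i v -> 0 < v < 1.
Proof.
rewrite /D /= in_itv/= => /andP[iv vi]; rewrite (lt_le_trans (eps_gt0 i) iv)/=.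
by rewrite (le_lt_trans vi)// gtrBl.
Qed.

Let D_nd : nondecreasing_seq D.
Proof.
move=> i j ij; rewrite subsetEset /D => v/=; rewrite !in_itv/= => /andP[iv vi].
have ji : eps j <= eps i by rewrite lef_pV2 ?posrE// ler_nat !ltnS.
by rewrite (le_trans ji iv)/= (le_trans vi)// lerB.
Qed.

Let D_cup : \bigcup_i D i = `]0, 1[%classic.
Proof.
apply/seteqP; split => v /=.
  by move=> [i _ /D_sub]; rewrite in_itv.
rewrite in_itv/= => /andP[v0 v1].
have m0 : 0 < Num.min v (1 - v) by rewrite lt_min v0 subr_gt0.
have [i im] : exists i, eps i < Num.min v (1 - v).
  by have /cvgr_lt/(_ _ m0) := eps_cvg; move=>[N _ /(_ N (leqnn N))]; exists N.
exists i => //; rewrite /D/= in_itv/=; move: im; rewrite lt_min => /andP[h1 h2].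
by rewrite ltW//= lerBrDl -lerBrDr ltW.
Qed.

(** Monotone convergence along the increasing sets [D i]; the limit may a priori be infinite. *)
Let ebeta_cvg c x y : 0 <= c ->
  (\int[mu]_(v in D i) (c * beta_kernel x y v)%:E @[i --> \oo] -->
   c%:E * \int[mu]_(v in `]0%R, 1%R[) (beta_kernel x y v)%:E)%E.
Proof.
move=> c0; rewrite -ge0_integralZl//; last 2 first.
- by apply/measurable_EFinP; exact: measurable_beta_kernel.
- by move=> v _; rewrite lee_fin beta_kernel_ge0.
rewrite -D_cup; apply: ge0_nondecreasing_set_cvg_integral => //.
- by move=> i; exact: measurable_itv.
- move=> i; apply/measurable_EFinP; apply: measurable_funM => //.
  exact: measurable_beta_kernel.
- by move=> i v _; rewrite lee_fin mulr_ge0// beta_kernel_ge0.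
Qed.

Let within_beta_kernel c x y i :
  {within D i, continuous (fun v => c * beta_kernel x y v)}.
Proof.
apply: derivable_within_continuous => v /D_sub v01.
by apply: derivableM => //; have [] := is_derive_beta_kernel x y v01.
Qed.

(** Fundamental theorem of calculus for [v^a (1 - v)^b] on [D i]; its value at [1 - eps i] is the
    kernel at [eps i] with swapped exponents. Keeping the two integrals on opposite sides avoids
    infinity minus infinity in the limit. *)
Let beta_kernel_FTC a b i :
  (\int[mu]_(v in D i) (a * beta_kernel (a - 1) b v)%:E =
   \int[mu]_(v in D i) (b * beta_kernel a (b - 1) v)%:E +
   (beta_kernel b a (eps i) - beta_kernel a b (eps i))%:E)%E.
Proof.
pose f v := a * beta_kernel (a - 1) b v.
pose g v := b * beta_kernel a (b - 1) v.
have int x y c : mu.-integrable (D i) (EFin \o (fun v => c * beta_kernel x y v)).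
  apply: continuous_compact_integrable; first exact: segment_compact.
  exact: within_beta_kernel.
have dk v : v \in `]eps i, (1 - eps i)[ -> 0 < v < 1.
  by move=> vi; apply: (@D_sub i); apply: subset_itv_oo_cc.
have := @continuous_FTC2 R (f \- g) (beta_kernel a b) _ _ (eps_lt i).
rewrite [beta_kernel a b (1 - eps i)]beta_kernel_sym => ftc.
rewrite EFinB -ftc; last 3 first.
- move=> v; apply: continuousB; exact: within_beta_kernel.
- split.
  + by move=> v /dk v01; have [] := is_derive_beta_kernel a b v01.
  + apply: cvg_at_right_filter.
    have v01 : 0 < eps i < 1 by apply: (@D_sub i); rewrite /D/= in_itv/= lexx ltW.
    have [+ _] := is_derive_beta_kernel a b v01.
    by move=> /derivable1_diffP/differentiable_continuous.
  + apply: cvg_at_left_filter.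
    have v01 : 0 < 1 - eps i < 1 by apply: (@D_sub i); rewrite /D/= in_itv/= lexx ltW.
    have [+ _] := is_derive_beta_kernel a b v01.
    by move=> /derivable1_diffP/differentiable_continuous.
- move=> v /dk v01; rewrite derive1E.
  by have [_ ->] := is_derive_beta_kernel a b v01.
rewrite -/(D i).
have -> : (\int[mu]_(x in D i) ((f \- g) x)%:E =
  \int[mu]_(v in D i) (f v)%:E - \int[mu]_(v in D i) (g v)%:E)%E.
  by rewrite -integralB_EFin//; [exact: measurable_itv|exact: int|exact: int].
rewrite addeC subeK//.
by apply: integrable_fin_num => //; [exact: measurable_itv|exact: int].
Qed.

Let beta_kernel_cvg0 a b : 0 < a -> 0 < b ->
  beta_kernel a b (eps i) @[i --> \oo] --> (0 : R).
Proof.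
move=> a0 b0.
apply: (@squeeze_cvgr _ _ _ _ (fun=> 0) (fun i => eps i `^ a)).
- near=> i; rewrite beta_kernel_ge0 beta_kernel_le_powR ?ltW//.
  by apply: (@D_sub i); rewrite /D/= in_itv/= lexx ltW.
- exact: cvg_cst.
- by have /cvg_at_rightP := powR_cvg0 a0; apply; split.
Unshelve. all: by end_near. Qed.

(* The difference of the two integrands is the derivative of v^a (1 - v)^b, which
   vanishes at 0 and 1. *)
Lemma ebeta_shift a b : 0 < a -> 0 < b ->
  (a%:E * ebeta a (b + 1) = b%:E * ebeta (a + 1) b)%E.
Proof.
move=> a0 b0; rewrite /ebeta !addrK.
have ha := @ebeta_cvg a (a - 1) b (ltW a0).
have hb := @ebeta_cvg b a (b - 1) (ltW b0).
have hG : (beta_kernel b a (eps i) - beta_kernel a b (eps i))%:E @[i --> \oo]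
    --> (0%R : R)%:E.
  apply: cvg_EFin; first by near=> i.
  by rewrite -[X in _ --> X](subr0 (0 : R)); apply: cvgB; exact: beta_kernel_cvg0.
(* The boundary term has a finite limit, so the limit of the sum is the sum of the limits even while
   the integrals may be infinite. *)
have := cvgeD (fin_num_adde_defl _ _) hb hG => /(_ _ erefl).
rewrite adde0 => /(_ _); rewrite -(funext (beta_kernel_FTC a b)).
exact: (cvg_unique _ ha).
Unshelve. all: by end_near. Qed.

Lemma ebeta_split a b :
  (ebeta a b = ebeta (a + 1) b + ebeta a (b + 1))%E.
Proof.
rewrite /ebeta -ge0_integralD//; last 4 first.
- by move=> v _; rewrite lee_fin beta_kernel_ge0.
- by apply/measurable_EFinP; exact: measurable_beta_kernel.
- by move=> v _; rewrite lee_fin beta_kernel_ge0.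
- by apply/measurable_EFinP; exact: measurable_beta_kernel.
apply: eq_integral => v; rewrite inE/= in_itv/= => v01.
by rewrite -EFinD [LHS]/= beta_kernel_split// !subrK !addrK.
Qed.

Lemma ebeta_ge0 a b : (0 <= ebeta a b)%E.
Proof. by apply: integral_ge0 => v _; rewrite lee_fin beta_kernel_ge0. Qed.

(** Splitting gives [a B(a,b) = a B(a+1,b) + a B(a,b+1)], and [ebeta_shift] turns the last term into
    [b B(a+1,b)]. *)
Lemma ebeta_sucl a b : 0 < a -> 0 < b ->
  (a%:E * ebeta a b = (a + b)%:E * ebeta (a + 1) b)%E.
Proof.
move=> a0 b0; rewrite ebeta_split ge0_muleDr ?ebeta_ge0// ebeta_shift//.
by rewrite -ge0_muleDl ?lee_fin ?ltW// EFinD.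
Qed.

Lemma ebeta_sucr a b : 0 < a -> 0 < b ->
  (b%:E * ebeta a b = (a + b)%:E * ebeta a (b + 1))%E.
Proof.
move=> a0 b0; rewrite ebeta_split ge0_muleDr ?ebeta_ge0// -ebeta_shift//.
by rewrite -ge0_muleDl ?lee_fin ?ltW// EFinD.
Qed.

Lemma ebeta_lty a b : 0 < a -> 0 < b -> (ebeta a b < +oo)%E.
Proof.
(* The recurrences reduce the claim to [ebeta (a + 1) (b + 1)], whose integrand is
   bounded by 1. *)
move=> a0 b0.
have lty x z (e e' : \bar R) : (x%:E * e = z%:E * e')%E -> 0 < x ->
    (0 <= e -> 0 <= e' -> e' < +oo -> e < +oo)%E.
  move=> + x0; case: e => [r|+ _|//]; first by rewrite ltry.
  by rewrite gt0_muley ?lte_fin//; case: e'.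
have a1 : 0 < a + 1 by rewrite addr_gt0.
apply: (lty _ _ _ _ (ebeta_sucl a0 b0)); rewrite ?ebeta_ge0//.
apply: (lty _ _ _ _ (ebeta_sucr a1 b0)); rewrite ?ebeta_ge0//.
apply: (@le_lt_trans _ _ (\int[mu]_(v in `]0%R, 1%R[) 1)%E).
  apply: le_ge0_integral => v; rewrite /= in_itv/= => v01; rewrite lee_fin.
    exact: beta_kernel_ge0.
  by rewrite beta_kernel_le1// addrK ltW.
by rewrite integral_cst//= mul1e lebesgue_measure_itv/= lte01 sube0 ltry.
Qed.

Lemma ebeta_gt0 a b : 0 < a -> 0 < b -> (0 < ebeta a b)%E.
Proof.
move=> a0 b0.
(* On [D 0 = [1/3, 2/3]] both [v] and [1 - v] are at least 1/3. The exponents are [a] and [b]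
   because [a - 1] may be negative, while [u^(a-1) >= u^a >= (1/3)^a] for [u] in [1/3, 1). *)
pose m : R := (3^-1) `^ a * (3^-1) `^ b.
have m0 : 0 < m by rewrite mulr_gt0// powR_gt0.
apply: (@lt_le_trans _ _ (\int[mu]_(v in D 0) m%:E)%E).
  rewrite integral_cst//=; last exact: measurable_itv.
  rewrite lebesgue_measure_itv/= lte_fin eps_lt -EFinD -EFinM lte_fin.
  by rewrite mulr_gt0// subr_gt0.
apply: (@le_trans _ _ (\int[mu]_(v in D 0) (beta_kernel (a - 1) (b - 1) v)%:E)%E).
  apply: le_ge0_integral => v; first by rewrite lee_fin ltW.
  move=> /[dup] /D_sub /andP[v0 v1]; rewrite /D/= in_itv/= => /andP[v3 v3'].
  have v3'' : 3^-1 <= 1 - v by rewrite lerBrDl -lerBrDr.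
  have w0 : 0 < 1 - v by rewrite subr_gt0.
  have pow x u : 0 < x -> 0 < u < 1 -> 3^-1 <= u -> (3^-1) `^ x <= u `^ (x - 1).
    move=> x0 /andP[u0 u1] u3; apply: (@le_trans _ _ (u `^ x)).
      by apply: ge0_ler_powR; rewrite ?nnegrE ?invr_ge0// ltW.
    by rewrite ger_powR ?u0 ?ltW// gtrBl.
  by rewrite lee_fin ler_pM ?powR_ge0// pow// ?v0// ?w0 gtrBl.
apply: ge0_subset_integral => //; first exact: measurable_itv.
- by apply/measurable_EFinP; exact: measurable_beta_kernel.
- by move=> v _; rewrite lee_fin beta_kernel_ge0.
- by rewrite -D_cup; exact: bigcup_sup.
Qed.

Lemma Beta_gt0 a b : 0 < a -> 0 < b -> 0 < Beta a b.
Proof.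
by move=> a0 b0; rewrite Beta_ebeta fine_gt0// ebeta_gt0// ebeta_lty.
Qed.

Lemma Beta_EFin a b : 0 < a -> 0 < b -> (Beta a b)%:E = ebeta a b.
Proof.
move=> a0 b0; rewrite Beta_ebeta fineK// ge0_fin_numE ?ebeta_ge0//.
exact: ebeta_lty.
Qed.

Lemma Beta_sucl a b : 0 < a -> 0 < b ->
  Beta (a + 1) b = a / (a + b) * Beta a b.
Proof.
move=> a0 b0; have := ebeta_sucl a0 b0.
rewrite -!Beta_EFin ?addr_gt0// -!EFinM => -[] e.
by rewrite mulrAC e mulrAC divff ?mul1r// gt_eqF// addr_gt0.
Qed.

Lemma Beta_sucr a b : 0 < a -> 0 < b ->
  Beta a (b + 1) = b / (a + b) * Beta a b.
Proof.
move=> a0 b0; have := ebeta_sucr a0 b0.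
rewrite -!Beta_EFin ?addr_gt0// -!EFinM => -[] e.
by rewrite mulrAC e mulrAC divff ?mul1r// gt_eqF// addr_gt0.
Qed.

(** Each unit increase of the first argument contributes one factor through [Beta_sucl]. *)
Lemma Beta_ratiol a b n : 0 < a -> 0 < b ->
  Beta (n%:R + a) b / Beta a b = \prod_(i < n) ((a + i%:R) / (a + b + i%:R)).
Proof.
move=> a0 b0; elim: n => [|n IHn].
  by rewrite big_ord0 add0r divff// gt_eqF// Beta_gt0.
have na : 0 < n%:R + a by rewrite ltr_wpDl.
rewrite big_ord_recr/= -IHn -natr1 addrAC Beta_sucl// [a + n%:R]addrC.
by rewrite -[n%:R + a + b]addrA [n%:R + (a + b)]addrC [RHS]mulrC mulrA.
Qed.

Lemma Beta_ratior a b n : 0 < a -> 0 < b ->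
  Beta a (n%:R + b) / Beta a b = \prod_(i < n) ((b + i%:R) / (a + b + i%:R)).
Proof.
move=> a0 b0; elim: n => [|n IHn].
  by rewrite big_ord0 add0r divff// gt_eqF// Beta_gt0.
have nb : 0 < n%:R + b by rewrite ltr_wpDl.
rewrite big_ord_recr/= -IHn -natr1 addrAC Beta_sucr// [b + n%:R]addrC.
by rewrite addrCA [n%:R + (a + b)]addrC [RHS]mulrC mulrA.
Qed.
End beta_recurrence.

(** * The logistic function and the integral of its derivative *)

Section expit.
Variable R : realType.
Implicit Types (x r : R).
Local Notation mu := (@lebesgue_measure R).

Lemma pE_gt0 x : 0 < pE x.
Proof. by rewrite divr_gt0 ?expR_gt0// addr_gt0// expR_gt0. Qed.

(** Reflection through which positivity and bounds of [pE] carry over to [qE]. *)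
Lemma qE_pEN x : qE x = pE (- x).
Proof.
rewrite /qE /pE expRN; have e0 := expR_gt0 x.
by field; rewrite ?gt_eqF// ?addr_gt0.
Qed.

Lemma qE_gt0 x : 0 < qE x.
Proof. by rewrite qE_pEN pE_gt0. Qed.

Lemma pE_le1 x : pE x <= 1.
Proof. by have := qE_gt0 x; rewrite /qE; lra. Qed.

Lemma qE_le1 x : qE x <= 1.
Proof. by rewrite qE_pEN pE_le1. Qed.

Lemma pE_ge_half x : 0 <= x -> 2^-1 <= pE x.
Proof.
move=> x0; have e1 := expR_ge1Dx x.
rewrite /pE ler_pdivlMr; last by lra.
lra.
Qed.

Lemma qE_ge_half x : x <= 0 -> 2^-1 <= qE x.
Proof. by move=> x0; rewrite qE_pEN pE_ge_half// oppr_ge0. Qed.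

Lemma is_derive_pE x : is_derive x 1 (@pE R) (pE x * qE x).
Proof.
have e0 := expR_gt0 x; have e1 : 1 + expR x != 0 by rewrite gt_eqF// addr_gt0.
have d1 : is_derive x 1 (fun u => 1 + expR u) (expR x).
  by rewrite -[X in is_derive _ _ _ X]add0r; apply: is_deriveD.
have d2 := @is_deriveV R (fun u => 1 + expR u) x _ 1 e1 d1.
have d3 := is_deriveM (is_derive_expR x) d2.
apply: is_derive_eq; rewrite /qE /pE /GRing.scale/=; field.
exact: e1.
Qed.

Lemma continuous_pE : continuous (@pE R).
Proof.
move=> x; apply/differentiable_continuous/derivable1_diffP.
by have [] := is_derive_pE x.
Qed.

Lemma continuous_pEqE : continuous (fun x : R => pE x * qE x).
Proof.
move=> x; apply: continuousM; first exact: continuous_pE.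
by apply: continuousB; [exact: cvg_cst|exact: continuous_pE].
Qed.

Lemma pE_cvgy : pE x @[x --> +oo] --> (1 : R).
Proof.
(* Dividing numerator and denominator by [expR x] leaves only [expR (- x)], which tends to 0. *)
rewrite (_ : @pE R = (fun x => (1 + expR (- x))^-1)); last first.
  apply/funext => x; rewrite /pE expRN; have e0 := expR_gt0 x.
  by field; rewrite ?gt_eqF// ?addr_gt0.
rewrite -[X in _ --> X]invr1; apply: cvgV; first exact: oner_neq0.
by rewrite -[X in _ --> X]addr0; apply: cvgD; [exact: cvg_cst|exact: cvgr_expR].
Qed.

(** The integrand is even, since reflection swaps [pE] and [qE], and it is the derivative of [pE];
    the integral is twice [1 - pE 0]. *)
Lemma integral_pEqE_lty :
  (\int[mu]_(x in [set: R]) (pE x * qE x)%:E < +oo)%E.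
Proof.
rewrite ge0_symfun_integralT.
- rewrite -set_itvcy (@ge0_continuous_FTC2y _ _ (@pE R) 0 1).
  + by rewrite -EFinB -EFinM ltry.
  + by move=> x _; rewrite mulr_ge0// ltW ?pE_gt0 ?qE_gt0.
  + exact/continuous_subspaceT/continuous_pEqE.
  + exact: pE_cvgy.
  + by move=> x _; have [] := is_derive_pE x.
  + by apply: cvg_at_right_filter; exact: continuous_pE.
  + by move=> x _; rewrite derive1E; have [_ ->] := is_derive_pE x.
- by move=> x; rewrite mulr_ge0// ltW ?pE_gt0 ?qE_gt0.
- exact: continuous_pEqE.
- by move=> x /=; rewrite !qE_pEN opprK mulrC.
Qed.

(** The constant [e] on [A], extended by zero, lies below [h] and already has infinite integral. [A]
    will be a half-line. *)
Lemma integralT_eqy (A : set R) (h : R -> \bar R) (e : R) :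
  measurable A -> mu A = +oo%E -> 0 < e ->
  (forall x, 0 <= h x)%E -> (forall x, A x -> e%:E <= h x)%E ->
  (\int[mu]_(x in [set: R]) h x = +oo)%E.
Proof.
move=> mA muA e0 h0 eh; apply/eqP; rewrite eq_le leey/=.
apply: (@le_trans _ _ (\int[mu]_(x in A) e%:E)%E).
  by rewrite integral_cst// [X in (_ * X)%E]muA gt0_muley ?lte_fin.
rewrite integral_mkcond; apply: le_ge0_integral => x _; rewrite /patch;
  case: ifPn => //; first by rewrite lee_fin ltW.
by rewrite inE => /eh.
Qed.

End expit.

(** * Bounds on Polya urn probabilities, uniform in [r] *)

Section polya_product.
Variable R : realType.
Implicit Types p r : R.

(** Probability that the first [n] draws of a Polya urn with initial weights [r p] and [r (1 - p)]
    and unit reinforcement are all successes; factor [i] is the conditional probability of success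
    after [i] successes. *)
Definition polya_prod p r n : R :=
  \prod_(i < n) ((r * p + i%:R) / (r + i%:R)).

(** The quotient is the average of [p] and 1 with weights [r] and [i]. *)
Lemma polya_factor_itv p r i : 0 < p <= 1 -> 0 < r ->
  p <= (r * p + i%:R) / (r + i%:R) <= 1.
Proof.
move=> /andP[p0 p1] r0; have i0 : 0 <= i%:R :> R by [].
have ri : 0 < r + i%:R by rewrite ltr_wpDr.
rewrite ler_pdivlMr// ler_pdivrMr// mul1r mulrDr [p * r]mulrC.
by rewrite lerD2l ler_piMl//= lerD2r ler_piMr// ltW.
Qed.

Lemma polya_prod_ge p r n : 0 < p <= 1 -> 0 < r -> p ^+ n <= polya_prod p r n.
Proof.
move=> p01 r0; have -> : p ^+ n = \prod_(i < n) p by rewrite prodr_const card_ord.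
apply: ler_prod => i _; have /andP[p0 _] := p01; rewrite ltW//=.
by have /andP[] := polya_factor_itv i p01 r0.
Qed.

Lemma polya_prod_ge0 p r n : 0 < p <= 1 -> 0 < r -> 0 <= polya_prod p r n.
Proof.
move=> p01 r0; apply: le_trans (polya_prod_ge n p01 r0).
by have /andP[p0 _] := p01; rewrite exprn_ge0// ltW.
Qed.

Lemma polya_prod_le1 p r n : 0 < p <= 1 -> 0 < r -> polya_prod p r n <= 1.
Proof.
move=> p01 r0; apply: prodr_ile1 => i _; have /andP[p0 _] := p01.
by have /andP[pi ->] := polya_factor_itv i p01 r0; rewrite (le_trans (ltW p0)).
Qed.

(** The factor [i = 0], present since [n] is positive, equals [p]; the others are at most 1. *)
Lemma polya_prod_le p r n : 0 < p <= 1 -> 0 < r -> (0 < n)%N ->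
  polya_prod p r n <= p.
Proof.
move=> p01 r0; case: n => // n _; have /andP[p0 _] := p01.
rewrite /polya_prod big_ord_recl/= !addr0 [r * p]mulrC mulfK ?gt_eqF//.
rewrite ler_piMr ?(ltW p0)//; apply: prodr_ile1 => i _.
rewrite [p * r]mulrC; have /andP[pi pi1] := polya_factor_itv i.+1 p01 r0.
by apply/andP; split; [exact: le_trans (ltW p0) pi|exact: pi1].
Qed.

End polya_product.

(** * The likelihood of extreme data *)

Section likelihood_extreme.
Variables (R : realType) (k : nat) (n y : 'I_k -> nat).
Implicit Types r x : R.

Let factor r x j : R := 'C(n j, y j)%:R *
  (Beta ((y j)%:R + r * pE x) ((n j - y j)%:R + r * qE x) /
   Beta (r * pE x) (r * qE x)).

Let pE01 x : 0 < pE x <= 1. Proof. by rewrite pE_gt0 pE_le1. Qed.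
Let qE01 x : 0 < qE x <= 1. Proof. by rewrite qE_gt0 qE_le1. Qed.

Let rpq r x : r * pE x + r * qE x = r.
Proof. by rewrite /qE -mulrDr addrC subrK mulr1. Qed.

(** The binomial coefficient is 1 and only the first Beta argument moves, so [Beta_ratiol] applies;
    the denominators are [r + i] by [rpq]. *)
Lemma factor_success r x j : 0 < r -> y j = n j ->
  factor r x j = polya_prod (pE x) r (n j).
Proof.
move=> r0 yn; rewrite /factor yn binn mul1r subnn add0r.
rewrite Beta_ratiol; [|exact: mulr_gt0 r0 (pE_gt0 x)|exact: mulr_gt0 r0 (qE_gt0 x)].
by apply: eq_bigr => i _; rewrite rpq.
Qed.

Lemma factor_failure r x j : 0 < r -> y j = 0%N ->
  factor r x j = polya_prod (qE x) r (n j).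
Proof.
move=> r0 y0; rewrite /factor y0 bin0 mul1r subn0 add0r.
rewrite Beta_ratior; [|exact: mulr_gt0 r0 (pE_gt0 x)|exact: mulr_gt0 r0 (qE_gt0 x)].
by apply: eq_bigr => i _; rewrite rpq.
Qed.

Lemma likelihood_ge_success r x : 0 < r -> (forall j, y j = n j) ->
  pE x ^+ (\sum_j n j) <= likelihood n y r x.
Proof.
move=> r0 yn; rewrite -prodrXr; apply: ler_prod => j _.
by rewrite -/(factor r x j) factor_success// exprn_ge0 ?polya_prod_ge// ltW ?pE_gt0.
Qed.

Lemma likelihood_ge_failure r x : 0 < r -> (forall j, y j = 0%N) ->
  qE x ^+ (\sum_j n j) <= likelihood n y r x.
Proof.
move=> r0 y0; rewrite -prodrXr; apply: ler_prod => j _.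
by rewrite -/(factor r x j) factor_failure// exprn_ge0 ?polya_prod_ge// ltW ?qE_gt0.
Qed.

Hypothesis extreme : forall j, y j = 0%N \/ y j = n j.

Let factor_itv r x j : 0 < r -> 0 <= factor r x j <= 1.
Proof.
move=> r0; have [y0|yn] := extreme j.
  by rewrite factor_failure// polya_prod_ge0// polya_prod_le1.
by rewrite factor_success// polya_prod_ge0// polya_prod_le1.
Qed.

Lemma likelihood_ge0 r x : 0 < r -> 0 <= likelihood n y r x.
Proof. by move=> r0; apply: prodr_ge0 => j _; have /andP[] := factor_itv x j r0. Qed.

Lemma likelihood_le_pEqE r x i j : 0 < r -> (0 < n i)%N -> (0 < n j)%N ->
  y i = n i -> y j = 0%N -> likelihood n y r x <= pE x * qE x.
Proof.
move=> r0 ni nj yi yj.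
(* One group cannot play both roles: [i = j] would give [n j = y j = 0]. *)
have ji : j != i.
  by apply/eqP => ji; move: nj; rewrite ji -yi -ji yj.
rewrite /likelihood (bigD1 i)//= (bigD1 j)//= mulrA -[leRHS]mulr1.
(* The factors of the other groups lie in [0, 1], so their product is bounded by 1 and drops out. *)
have prod_itv (P : pred 'I_k) : 0 <= \prod_(l | P l) factor r x l <= 1.
  rewrite prodr_ge0 ?prodr_ile1//= => l _; first exact: factor_itv.
  by have /andP[] := factor_itv x l r0.
have /andP[rest0 rest1] := prod_itv (fun l => (l != i) && (l != j)).
rewrite -/(factor r x i) -/(factor r x j).
have /andP[fi0 _] := factor_itv x i r0; have /andP[fj0 _] := factor_itv x j r0.
apply: ler_pM; [exact: mulr_ge0|exact: rest0| |exact: rest1].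
apply: ler_pM => //.
  by rewrite factor_success// polya_prod_le.
by rewrite factor_failure// polya_prod_le.
Qed.

End likelihood_extreme.

(** * Integration over [r] against its prior *)

Section posterior_mass.
Variables (R : realType) (f : R -> R).
Hypothesis pdf_f : is_pdf_on_pos f.
Local Notation mu := (@lebesgue_measure R).

Let integral_pdfZ (a : R) : 0 <= a ->
  (\int[mu]_(r in `]0%R, +oo[) (a * f r)%:E = a%:E)%E.
Proof.
have [mf f0 f1] := pdf_f => a0.
rewrite -[RHS]mule1 -f1 -ge0_integralZl//; first exact/measurable_EFinP.
by move=> r /=; rewrite in_itv/= andbT lee_fin => /f0.
Qed.

(** A bound uniform in [r] comes out of the integral because [f] has mass 1. Here [c] is meant as
    the flat prior's constant and [h] as the likelihood in [r]. *)
Lemma integral_pdf_ler (c M : R) (h : R -> R) : 0 <= c ->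
  (forall r, 0 < r -> 0 <= h r) -> (forall r, 0 < r -> h r <= M) ->
  (\int[mu]_(r in `]0%R, +oo[) (f r * c * h r)%:E <= (c * M)%:E)%E.
Proof.
have [mf f0 f1] := pdf_f => c0 h0 hM.
have M0 : 0 <= M by apply: le_trans (hM 1 _); rewrite ?h0.
rewrite -[leRHS]integral_pdfZ ?mulr_ge0//.
apply: le_ge0_integral => r; rewrite /= in_itv/= andbT => r0; rewrite lee_fin.
  by rewrite !mulr_ge0// ?f0 ?h0.
by rewrite [leRHS]mulrC mulrA ler_wpM2l ?mulr_ge0 ?f0 ?hM.
Qed.

Lemma integral_pdf_ger (c m : R) (h : R -> R) : 0 <= c -> 0 <= m ->
  (forall r, 0 < r -> m <= h r) ->
  ((c * m)%:E <= \int[mu]_(r in `]0%R, +oo[) (f r * c * h r)%:E)%E.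
Proof.
have [mf f0 f1] := pdf_f => c0 m0 mh.
rewrite -[leLHS]integral_pdfZ ?mulr_ge0//.
apply: le_ge0_integral => r; rewrite /= in_itv/= andbT => r0; rewrite lee_fin.
  by rewrite !mulr_ge0// f0.
by rewrite [leLHS]mulrC mulrA ler_wpM2l ?mulr_ge0 ?f0 ?mh.
Qed.

End posterior_mass.

Local Close Scope classical_set_scope.

(** * Propriety of the posterior *)

Theorem theorem3p4 (R : realType) (k : nat) (n y : 'I_k -> nat) (f g : R -> R)
    (hk : (1 <= k)%N)
    (hn : forall j, (1 <= n j)%N)
    (hy : forall j, (y j <= n j)%N)
    (hextreme : forall j, y j = 0%N \/ y j = n j)
    (hf : is_pdf_on_pos f)
    (hg : is_flat g) :
  hyp_post_proper n y f g <->
  (1 <= \sum_(j < k) (y j == n j))%N /\ (1 <= \sum_(j < k) (y j == 0))%N.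
Proof.
have [c c0 gc] := hg.
have f0 r : 0 < r -> 0 <= f r by have [_ + _] := hf; apply.
have count_gt0 (P : pred 'I_k) : (1 <= \sum_(j < k) P j)%N <-> exists j, P j.
  rewrite lt0n sum_nat_eq0 negb_forall; split.
    by move=> /existsP[j]; rewrite eqb0 negbK; exists j.
  by move=> [j Pj]; apply/existsP; exists j; rewrite /= Pj.
pose inner x := (\int[@lebesgue_measure R]_(r in `]0%R, +oo[%classic)
  (f r * g x * likelihood n y r x)%:E)%E.
have inner_ge0 x : (0 <= inner x)%E.
  apply: integral_ge0 => r; rewrite /= in_itv/= andbT => r0.
  by rewrite lee_fin !mulr_ge0 ?f0 ?gc ?likelihood_ge0// ltW.
(* Lower bound for [inner] on a half-line: [g] contributes [c], and each trial contributes 1/2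
   because [pE] or [qE] is at least 1/2 there. *)
have half_gt0 : 0 < c * 2^-1 ^+ (\sum_j n j) by rewrite mulr_gt0// exprn_gt0.
rewrite /hyp_post_proper /hyp_post_mass -/inner !count_gt0; split.
  move=> proper; split; apply: contrapT => nP.
  (* With no all-success group, all groups are failures; [qE] is at least 1/2 on the nonpositive
     half-line. *)
  - have y0 j : y j = 0%N.
      by have [//|yn] := hextreme j; case: nP; exists j; rewrite yn eqxx.
    suff e : (\int[@lebesgue_measure R]_(x in [set: R]) inner x = +oo)%E.
      by move: proper; rewrite e ltxx.
    apply: (@integralT_eqy _ `]-oo, 0%R]%classic _ _ _ _ half_gt0) => //.
      by rewrite lebesgue_measure_itv/= ?ltNyr ?ltry.
    move=> x; rewrite /= in_itv/= => x0; rewrite /inner gc.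
    apply: (integral_pdf_ger hf (ltW c0)) => [|r r0]; first exact: exprn_ge0.
    apply: le_trans (likelihood_ge_failure n x r0 y0).
    by rewrite lerXn2r ?nnegrE ?qE_ge_half// ltW ?qE_gt0.
  (* The mirror case: all groups are successes, and the nonnegative half-line bounds [pE] from
     below. *)
  - have yn j : y j = n j.
      by have [y0|//] := hextreme j; case: nP; exists j; rewrite y0 eqxx.
    suff e : (\int[@lebesgue_measure R]_(x in [set: R]) inner x = +oo)%E.
      by move: proper; rewrite e ltxx.
    apply: (@integralT_eqy _ `[0%R, +oo[%classic _ _ _ _ half_gt0) => //.
      by rewrite lebesgue_measure_itv/= ?ltNyr ?ltry.
    move=> x; rewrite /= in_itv/= andbT => x0; rewrite /inner gc.
    apply: (integral_pdf_ger hf (ltW c0)) => [|r r0]; first exact: exprn_ge0.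
    apply: le_trans (likelihood_ge_success x r0 yn).
    by rewrite lerXn2r ?nnegrE ?pE_ge_half// ltW ?pE_gt0.
move=> [[i /eqP yi] [j /eqP yj]].
(* The majorant is [c] times the logistic density; the witnesses [i] and [j] supply the factors
   [pE x] and [qE x]. *)
apply: (@le_lt_trans _ _ (\int[@lebesgue_measure R]_(x in [set: R])
    (c%:E * (pE x * qE x)%:E))%E).
  apply: le_ge0_integral => [x _|x _]; first exact: inner_ge0.
  rewrite /inner gc -EFinM.
  apply: (integral_pdf_ler hf (ltW c0)) => r r0.
    exact: likelihood_ge0.
  exact: (likelihood_le_pEqE hextreme x r0 (hn i) (hn j) yi yj).
rewrite ge0_integralZl//.
- rewrite lte_mul_pinfty ?lee_fin ?(ltW c0)//; exact: integral_pEqE_lty.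
- by apply/measurable_EFinP; exact: continuous_measurable_fun (@continuous_pEqE R).
- by move=> x _; rewrite lee_fin mulr_ge0// ltW ?pE_gt0 ?qE_gt0.
- by rewrite lee_fin ltW.
Qed.
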